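(* Let $\mathscr{L}$ be a (continuous) line bundle over an $n$-sphere $S$ in $\mathbb{R}^{n+1}$. Then $\operatorname{int}(\Delta_* \mathscr{L}) \neq \varnothing$.
   Context: An $n$-sphere in $\mathbb{R}^{n+1}$ is a set $\{x\in\mathbb{R}^{n+1}:\|x-c\|=R\}$ with $R>0$. A line bundle over $S$ means the embedded bundle $\mathscr{L}=\{(p,u)\in S\times\mathbb{R}^{n+1}: u\in\varphi(p)\}$ defined by a continuous map $\varphi:S\to\mathbb{P}^n=\operatorname{Gr}_1(n+1)$ into the space of lines through $0$ in $\mathbb{R}^{n+1}$. The codiagonal map is $\Delta_*(x,y)=x+y$, so $\Delta_*\mathscr{L}=\bigcup_{p\in S}(p+\varphi(p))\subseteq\mathbb{R}^{n+1}$. $\operatorname{int}$ denotes interior in $\mathbb{R}^{n+1}$. *)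

(* Defs.v *)
(* MathComp / MathComp-Analysis. *)
From HB Require Import structures.
From mathcomp Require Import all_boot all_order all_algebra.
From mathcomp Require Import all_classical all_reals all_analysis.

Set Implicit Arguments.
Unset Strict Implicit.
Unset Printing Implicit Defensive.

Import Order.TTheory GRing.Theory Num.Theory.
Import numFieldNormedType.Exports.

Local Open Scope classical_set_scope.
Local Open Scope ring_scope.

(* The library norm `|x| on row vectors is the sup norm, so the Euclidean norm
   is introduced here; the library topology on 'rV[R]_m is the usual one. *)
Definition enorm (R : realType) (m : nat) (x : 'rV[R]_m) : R :=
  Num.sqrt (\sum_(i < m) x 0 i ^+ 2).

Definition is_sphere (R : realType) (n : nat) (S : set 'rV[R]_n.+1) : Prop :=
  exists (c : 'rV[R]_n.+1) (r : R), 0 < r /\ S = [set x | enorm (x - c) = r].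

Definition nonzero (R : realType) (n : nat) : set 'rV[R]_n.+1 :=
  [set v | v != 0].
Arguments nonzero : clear implicits.

Definition line (R : realType) (n : nat) : Type :=
  {l : {vspace 'rV[R]_n.+1} | \dim l == 1%N}.

Section ProjectiveSpace.
Variables (R : realType) (n : nat).

Lemma dim_span_nonzero (v : nonzero R n) : \dim <[set_val v]>%VS == 1%N.
Proof. have v0 : set_val v != 0 by exact: (set_mem (valP v)).
by rewrite dim_vline v0. Qed.

Definition span_line (v : nonzero R n) : line R n :=
  exist _ <[set_val v]>%VS (dim_span_nonzero v).

Lemma vpick_line_nonzero (l : line R n) : nonzero R n (vpick (sval l)).
Proof.
by rewrite /nonzero /= vpick0 -dimv_eq0; case: l => l /= /eqP ->.
Qed.

Definition line_repr (l : line R n) : nonzero R n :=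
  SigSub (mem_set (vpick_line_nonzero l)).

Lemma line_reprK : cancel line_repr span_line.
Proof.
move=> l; apply: val_inj => /=; apply/eqP.
rewrite eqEdim -memvE memv_pick dim_vline.
by have := vpick_line_nonzero l; rewrite /nonzero /= => ->; case: l => l /= /eqP ->.
Qed.

(* The lines through 0 as the quotient of the nonzero vectors by the map
   v |-> <[v]>. *)
HB.instance Definition _ := isQuotient.Build (nonzero R n) (line R n) line_reprK.

(* The real projective space P^n, i.e. Gr_1(n+1): the set of lines through 0,
   with the quotient topology of R^{n+1} \ {0}. *)
Definition projective_space : Type := quotient_topology (line R n).
HB.instance Definition _ := Quotient.on projective_space.
HB.instance Definition _ := Topological.on projective_space.

Definition line_of (l : projective_space) : {vspace 'rV[R]_n.+1} :=
  sval (l : line R n).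

Lemma line_of_pi (v : nonzero R n) :
  line_of (\pi_projective_space%qT v) = <[set_val v]>%VS.
Proof. by rewrite !unlock. Qed.

Lemma projective_space_openE (U : set projective_space) :
  open U <-> open [set v : nonzero R n | U (span_line v)].
Proof.
rewrite {1}/open /= /quotient_open.
suff -> : \pi_projective_space%qT @^-1` U
          = [set v : nonzero R n | U (span_line v)] by [].
by apply/seteqP; split => v /=; rewrite !unlock.
Qed.

End ProjectiveSpace.

(* A map S -> P^n is given by a total function, of which only the restriction
   to S matters. *)
Definition embedded_bundle (R : realType) (n : nat) (S : set 'rV[R]_n.+1)
    (phi : 'rV[R]_n.+1 -> projective_space R n) :
    set ('rV[R]_n.+1 * 'rV[R]_n.+1) :=
  [set pu | S pu.1 /\ pu.2 \in line_of (phi pu.1)].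

Definition is_line_bundle (R : realType) (n : nat) (S : set 'rV[R]_n.+1)
    (L : set ('rV[R]_n.+1 * 'rV[R]_n.+1)) : Prop :=
  exists phi : 'rV[R]_n.+1 -> projective_space R n,
    {within S, continuous phi} /\ L = embedded_bundle S phi.

Definition codiagonal (V : zmodType) (xy : V * V) : V := xy.1 + xy.2.

(* Main.v *)
Require Import Defs.
From mathcomp Require Import all_boot all_order all_algebra.
From mathcomp Require Import all_classical all_reals all_analysis.
From mathcomp Require Import ring lra.
Import numFieldNormedType.Exports.

(** Suppose that the union of the affine lines [p + phi p] has empty interior.
Then it misses some point [a] inside the sphere and some point [b] outside it.
Assume first that the line bundle has a nowhere zero section [v].  Since [phi p]
never contains [p - a], the segment from [p - a] to [v p] avoids the origin for
every [p] on the sphere, and so does the segment from [v p] to [p - b].  Hence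
the fields [p - a] and [p - b] are homotopic among nowhere zero fields on the
sphere.  The field [p - b] extends to the ball without zeros because [b] lies
outside, so [p - a] does too; prolonged by [x - a] outside the ball, it gives a
continuous map of the whole space without zeros which is a translation far away
([no_transversal_field]).  No such map exists, by a form of Brouwer's theorem
([zero_of_identity_far]).

It remains to find the section ([transversal_line_section]).  If the
space has dimension at least 3, the sphere is simply connected and every line
bundle over it is trivial ([sphere_line_field_section]): over each closed hemisphere a section is obtained
by transporting a vector along segments from the pole, each step being an
orthogonal projection onto the next line ([line_field_star_section]); the two
sections agree up to a sign on the equator, and this sign is constant because
the equator is connected.  In the plane the equator is disconnected and the
bundle may be a Moebius band, but there the missed point [a] helps: a quarter
turn of [p - a] is never orthogonal to [phi p], so its projection to [phi p] is
a section.  On the real line every [phi p] is the whole line, so that nothing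
can be missed.

The form of Brouwer's theorem rests on a mod 2 count in a cubical grid.  If
bits [b_i] on the vertices equal 0 on the face [x_i = 0] and 1 on the opposite
face, then some unit cube shows both values of every bit ([cubical_sperner]):
the cup product of the coboundaries of the [b_i] is itself a coboundary, so its
sum over all unit cubes is a boundary sum, which by induction on the dimension
equals 1. *)

Set Implicit Arguments.
Unset Strict Implicit.
Unset Printing Implicit Defensive.

Import Order.TTheory GRing.Theory Num.Theory.

Local Open Scope ring_scope.

(** * Cup products of bits on a cubical grid *)

Lemma addbool_self (b : bool) : b + b = 0.
Proof. by case: b. Qed.

(** Every unordered pair is counted twice. *)
Lemma sum_symmetric_pairs (D : nat) (A : {set 'I_D})
    (s : 'I_D -> 'I_D -> bool) :
  (forall i j, s i j = s j i) ->
  \sum_(i in A) \sum_(j in A :\ i) s i j = 0.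
Proof.
move=> s_sym; rewrite pair_big_dep /=.
rewrite (bigID (fun p : 'I_D * 'I_D => p.1 < p.2)%N) /=.
have swapK : involutive (fun p : 'I_D * 'I_D => (p.2, p.1)) by case.
rewrite [X in _ + X](reindex_inj (inv_inj swapK)) /=.
rewrite [X in _ + X](eq_big
  (fun p : 'I_D * 'I_D => (p.1 \in A) && (p.2 \in A :\ p.1) && (p.1 < p.2)%N)
  (fun p => s p.1 p.2)) ?addbool_self //.
move=> [i j] /=; rewrite !inE -!(inj_eq val_inj) /=.
by case: ltngtP; case: (i \in A); case: (j \in A).
Qed.

Section CupProduct.
Variables (D : nat) (V : zmodType) (e : 'I_D -> V).

(** Serre's formula for the cup product of the mod 2 coboundaries of the bits
[bs], evaluated on the cube with lowest vertex [x] and directions [A]: a sum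
over the monotone edge paths across the cube, in which the [i]-th edge
contributes the variation of the [i]-th bit. *)
Fixpoint cup (bs : seq (V -> bool)) (A : {set 'I_D}) (x : V) : bool :=
  if bs is b :: bs' then
    \sum_(j in A) (b x + b (x + e j)) * cup bs' (A :\ j) (x + e j)
  else 1.

(** The cup product is a cocycle: upper and lower facets of a cube contribute
equally.  Two consecutive edges of a path may be exchanged without moving its
other vertices, so in the double sum below everything symmetric in the two
directions cancels; this lets the first edge start at [x] instead of [x + e j],
after which the induction hypothesis applies to the rest of the path. *)
Lemma cup_closed (bs : seq (V -> bool)) (A : {set 'I_D}) (x : V) :
  \sum_(j in A) cup bs (A :\ j) (x + e j) = \sum_(j in A) cup bs (A :\ j) x.
Proof.
elim: bs A x => [|b bs IH] A x //=.
pose C i j := cup bs (A :\ i :\ j) (x + e i + e j).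
have C_sym i j : C i j = C j i.
  rewrite /C -!addrA [e i + _]addrC; congr (cup _ _ _).
  by apply/setP => k; rewrite !inE andbCA.
transitivity (\sum_(i in A) \sum_(j in A :\ i) (b x + b (x + e i)) * C i j).
  rewrite -[RHS]addr0.
  rewrite -[X in _ = _ + X](@sum_symmetric_pairs D A
    (fun i j => (b x + b (x + e i + e j)) * C i j)); last first.
    by move=> i j; rewrite C_sym -!addrA [e i + _]addrC.
  rewrite -big_split; apply: eq_bigr => i _.
  rewrite -big_split; apply: eq_bigr => j _ /=.
  rewrite -mulrDl; congr (_ * _).
  by case: (b x); case: (b _); case: (b _).
transitivity (\sum_(i in A) \sum_(j in A :\ i)
    (b x + b (x + e i)) * cup bs (A :\ i :\ j) (x + e i)).
  by apply: eq_bigr => i _; rewrite -!mulr_sumr IH.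
rewrite (exchange_big_dep [in A]) /=; last by move=> i j _; rewrite !inE => /andP[].
apply: eq_bigr => j jA; apply: eq_big => [i|i _].
  by rewrite !inE jA andbT andbC eq_sym.
by congr (_ * cup _ _ _); apply/setP => k; rewrite !inE andbCA.
Qed.

(** Discrete Leibniz rule: as the remaining factors form a cocycle, the cup
product is the coboundary of [h]. *)
Lemma cup_coboundary (b : V -> bool) (bs : seq (V -> bool)) (A : {set 'I_D})
    (x : V) (h := fun j y => b y * cup bs (A :\ j) y) :
  cup (b :: bs) A x = \sum_(j in A) (h j x + h j (x + e j)).
Proof.
rewrite /= big_split /= /h -mulr_sumr -cup_closed mulr_sumr -big_split.
by apply: eq_bigr => j _; rewrite mulrDl.
Qed.

End CupProduct.

Section CubicalSperner.
Variables (D N : nat).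
Local Notation grid := {ffun 'I_D -> 'I_N.+2}.
Implicit Types (A : {set 'I_D}) (x y : grid).

(** Grid points have coordinates in the cyclic group of order [N + 2], which
makes translations bijective.  The price is that [-1] stands for the last index
and that cubes wrapping around have to be excluded. *)
Definition unit_step (j : 'I_D) : grid := [ffun i => (i == j)%:R].

(** Lowest vertices of the unit cubes, with directions [A], of the face where
the other coordinates are maximal. *)
Definition grid_box A : {set grid} :=
  [set x : grid | [forall i, (x i == -1) == (i \notin A)]].

Lemma grid_boxP A x i : x \in grid_box A -> (x i == -1) = (i \notin A).
Proof. by rewrite inE => /forallP/(_ i)/eqP. Qed.

(** The sum telescopes along the lines of direction [j], and only their end
points survive; [h] vanishes at the initial ones. *)
Lemma grid_box_telescope A (j : 'I_D) (h : grid -> bool) : j \in A ->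
  (forall y, y j = 0 -> h y = 0) ->
  \sum_(x in grid_box A) (h x + h (x + unit_step j))
    = \sum_(x in grid_box (A :\ j)) h x.
Proof.
move=> jA h0; rewrite big_split /=.
rewrite [X in _ + X](reindex_inj (addIr (- unit_step j))) /=.
under [X in _ + X]eq_bigr do rewrite subrK.
rewrite big_mkcond [X in _ + X]big_mkcond [RHS]big_mkcond -big_split /=.
apply: eq_bigr => y _.
pose F := [forall i, (i != j) ==> ((y i == -1) == (i \notin A))].
have splitF (z : grid) (B : {set 'I_D}) :
    (forall i, i != j -> z i = y i /\ (i \in B) = (i \in A)) ->
    (z \in grid_box B) = F && ((z j == -1) == (j \notin B)).
  move=> zy; rewrite inE; apply/forallP/andP => [zB|[/forallP HF zj] i].
    split; last exact: zB.
    apply/forallP => i; apply/implyP => ij.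
    by have := zB i; have [-> ->] := zy _ ij.
  have [->//|ij] := eqVneq i j.
  by have := HF i; rewrite ij /=; have [-> ->] := zy _ ij.
rewrite (splitF y A) // (splitF (y - unit_step j) A); last first.
  by move=> i ij; rewrite !ffunE (negbTE ij) subr0.
rewrite (splitF y (A :\ j)); last by move=> i ij; rewrite !inE ij.
rewrite !inE jA eqxx /= !ffunE eqxx /= !eqbF_neg eqb_id.
have -> : (y j - 1 == -1) = (y j == 0) by rewrite -subr_eq0 opprK subrK.
have [y0|_] := eqVneq (y j) 0; first by rewrite h0 //; do !case: ifP.
by case: (F); case: (y j == -1); case: (h y).
Qed.

Variable b : 'I_D -> grid -> bool.
Hypothesis b0 : forall i y, y i = 0 -> b i y = 0.
Hypothesis b1 : forall i y, y i = -1 -> b i y = 1.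

(** On a face orthogonal to [i] the bit [b i] is constant, so every path has a
factor 0. *)
Lemma cup_face_eq0 (l : seq 'I_D) A x (i : 'I_D) : i \in l -> i \notin A ->
  (x i == 0) || (x i == -1) -> cup unit_step (map b l) A x = 0.
Proof.
elim: l A x => [//|j l IH] A x; rewrite inE => il iA xi /=.
apply: big1 => t tA.
have ti : (x + unit_step t) i = x i.
  by rewrite !ffunE; case: eqVneq => [it|_]; [by rewrite it tA in iA|rewrite addr0].
have [ij|ij] := eqVneq i j.
  rewrite -ij; case/orP: xi => /eqP xi.
    by rewrite !b0 ?mul0r // ti.
  by rewrite !b1 ?addbool_self ?mul0r // ti.
rewrite (negbTE ij) /= in il; rewrite IH ?mulr0 ?ti //.
by rewrite !inE (negbTE iA) andbF.
Qed.

(** Stokes: by [cup_coboundary] the sum reduces to the facets.  Those orthogonal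
to a direction other than [j] contribute nothing, since a bit of [l] is constant
there; among the two orthogonal to [j], the bit [b j] kills the lower one and
is 1 on the upper one, which leaves the same sum in one dimension less. *)
Lemma sum_cup_grid_box (l : seq 'I_D) : uniq l ->
  \sum_(x in grid_box [set i in l]) cup unit_step (map b l) [set i in l] x = 1.
Proof.
elim: l => [_|j l IH].
  rewrite (big_pred1 [ffun=> -1]) // => x; rewrite inE.
  apply/forallP/eqP => [xN|-> i]; last by rewrite !inE ffunE eqxx.
  by apply/ffunP => i; have := xN i; rewrite !inE ffunE => /eqP/eqP.
rewrite cons_uniq => /andP[jl ul]; set A := [set i in j :: l].
have jA : j \in A by rewrite inE mem_head.
have Aj : A :\ j = [set i in l].
  by apply/setP => i; rewrite !inE; case: eqVneq => [->|//]; rewrite (negbTE jl).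
under eq_bigr do rewrite (cup_coboundary _ (b j) (map b l)).
rewrite exchange_big /= (bigD1 j) //= [X in _ + X]big1 => [|i /andP[iA ij]].
  rewrite addr0 (grid_box_telescope (h := fun y => b j y * _)) //; last first.
    by move=> y /b0 ->; rewrite mul0r.
  rewrite Aj -[RHS](IH ul); apply: eq_bigr => x xl.
  by rewrite b1 ?mul1r //; apply/eqP; rewrite (grid_boxP _ xl) inE.
have il : i \in l by move: iA; rewrite !inE (negbTE ij).
have h0 y : (y i == 0) || (y i == -1) ->
    b j y * cup unit_step (map b l) (A :\ i) y = 0.
  by move=> yi; rewrite (cup_face_eq0 il) ?mulr0 // !inE eqxx.
rewrite (grid_box_telescope (h := fun y => b j y * _)) //; last first.
  by move=> y yi; rewrite h0 ?yi.
by apply: big1 => y yA; rewrite h0 // (grid_boxP _ yA) !inE eqxx orbT.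
Qed.

(** A nonzero cup product has a path along which every bit varies. *)
Lemma cup_bichromatic (l : seq 'I_D) A x (i : 'I_D) : i \in l ->
    cup unit_step (map b l) A x ->
  exists y z : grid, [/\ b i y, ~~ b i z &
    forall w, w \in [:: y; z] ->
      forall k, w k = x k \/ (k \in A /\ w k = x k + 1)].
Proof.
elim: l A x => [//|j l IH] A x il /= cupx.
have [t tA] : exists2 t, t \in A &
    (b j x + b j (x + unit_step t)) * cup unit_step (map b l) (A :\ t)
      (x + unit_step t) != 0.
  apply/exists_inP; apply: contraTT cupx; rewrite negb_exists_in.
  by move/forall_inP => cup0; rewrite big1 // => t /cup0 /negPn /eqP.
rewrite mulf_eq0 negb_or => /andP[bj cupl].
have step k : (x + unit_step t) k = x k + (k == t)%:R by rewrite !ffunE.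
have [ij|ij] := eqVneq i j.
  have stepA k : (x + unit_step t) k = x k \/
      (k \in A /\ (x + unit_step t) k = x k + 1).
    by rewrite step; case: eqVneq => [->|_]; [right|left; rewrite addr0].
  rewrite -ij in bj; case bx: (b i x) bj; case bxt: (b i (x + _)) => // _.
    exists x, (x + unit_step t); rewrite bx bxt; split=> // w.
    by rewrite !inE => /orP[]/eqP-> k; [left|apply: stepA].
  exists (x + unit_step t), x; rewrite bx bxt; split=> // w.
  by rewrite !inE => /orP[]/eqP-> k; [apply: stepA|left].
have {}il : i \in l by move: il; rewrite inE (negbTE ij).
have [|y [z [by_ bz yz]]] := IH (A :\ t) (x + unit_step t) il.
  by case: (cup _ _ _ _) cupl.
exists y, z; split=> // w /yz {}yz k; case: (yz k); rewrite step ?inE.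
  by move=> ->; case: eqVneq => [->|_]; [right|left; rewrite addr0].
by case=> /andP[kt kA] ->; right; rewrite (negbTE kt) addr0.
Qed.

End CubicalSperner.

(** Kuhn's cubical form of Sperner's lemma. *)
Lemma cubical_sperner (D N : nat) (b : 'I_D -> {ffun 'I_D -> 'I_N.+2} -> bool) :
    (forall i (y : {ffun 'I_D -> 'I_N.+2}), y i = 0%N :> nat -> ~~ b i y) ->
    (forall i (y : {ffun 'I_D -> 'I_N.+2}), y i = N.+1 :> nat -> b i y) ->
  exists x : {ffun 'I_D -> 'I_N.+2}, forall i,
  exists y z : {ffun 'I_D -> 'I_N.+2},
    [/\ b i y, ~~ b i z &
      forall w, w \in [:: y; z] -> forall k, (x k <= w k <= (x k).+1)%N].
Proof.
move=> b0 b1.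
have N1 : (-1 : 'I_N.+2) = N.+1 :> nat by rewrite /= !modn_small.
have [x xbox cupx] : exists2 x, x \in grid_box (D:=D) N [set i in enum 'I_D] &
    cup (@unit_step D N) (map b (enum 'I_D)) [set i in enum 'I_D] x.
  apply/exists_inP/contraT; rewrite negb_exists_in => /forall_inP cup0.
  have := sum_cup_grid_box (b := b) _ _ (enum_uniq 'I_D).
  rewrite big1 => [H|x /cup0 /negbTE //]; suff: (0 : bool) = 1 by [].
  apply: H => [i y yi|i y yi]; first by apply/negbTE/b0; rewrite yi.
  by apply/b1; rewrite yi N1.
have i_enum i : i \in enum 'I_D by rewrite mem_enum.
exists x => i; have [y [z [by_ bz yz]]] := cup_bichromatic (i_enum i) cupx.
exists y, z; split=> // w /yz {}yz k; case: (yz k) => [->|[_ ->]].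
  by rewrite leqnn leqnSn.
have xk : (x k < N.+1)%N.
  have : x k != -1 by rewrite (grid_boxP _ xbox) inE i_enum.
  by rewrite ltn_neqAle -ltnS ltn_ord andbT -(inj_eq val_inj) /= [X in _ != X]N1.
by rewrite /= !modn_small ?addn1 ?ltnS ?leqnn ?leqnSn.
Qed.

Local Open Scope classical_set_scope.

(** * Continuity at a point and norms of row vectors *)

Lemma continuous_at_id (T : topologicalType) (t : T) : {for t, continuous id}.
Proof. exact: cvg_id. Qed.

Lemma eq_continuous_at (T U : topologicalType) (f g : T -> U) t :
  f =1 g -> {for t, continuous g} -> {for t, continuous f}.
Proof. by move=> /funext ->. Qed.

Lemma continuous_at_cst (T U : topologicalType) (a : U) (t : T) :
  {for t, continuous (fun=> a)}.
Proof. exact: cvg_cst. Qed.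

Lemma continuous_add (R : realType) (T : topologicalType)
    (W : normedModType R) (f g : T -> W) t :
  {for t, continuous f} -> {for t, continuous g} ->
  {for t, continuous (fun s => f s + g s)}.
Proof. exact: continuousD. Qed.

Lemma continuous_scale (R : realType) (T : topologicalType)
    (W : normedModType R) (c : T -> R) (f : T -> W) t :
  {for t, continuous c} -> {for t, continuous f} ->
  {for t, continuous (fun s => c s *: f s)}.
Proof. exact: continuousZ. Qed.

Lemma continuous_sum (R : realType) (T : topologicalType)
    (W : normedModType R) (I : Type) (s : seq I) (f : I -> T -> W) t :
  (forall i, {for t, continuous (f i)}) ->
  {for t, continuous (fun t' => \sum_(i <- s) f i t')}.
Proof.
move=> cf; elim: s => [|i s IH].
  by apply: (eq_continuous_at (fun t' => big_nil _ _ _ _)); apply: cvg_cst.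
apply: (eq_continuous_at (fun t' => big_cons _ _ _ _ _ _)).
exact: continuousD (cf i) IH.
Qed.

Lemma near_continuous_at (T U : topologicalType) (f g : T -> U) (t : T) :
  {near t, f =1 g} -> {for t, continuous f} -> {for t, continuous g}.
Proof.
move=> fg; rewrite /prop_for /continuous_at -(nbhs_singleton fg) => cf.
by apply: cvg_trans cf; apply: near_eq_cvg.
Qed.

(** Where [c] does not vanish, the same branch is selected in a whole
neighbourhood. *)
Lemma continuous_glue (R : realType) (T : topologicalType)
    (W : normedModType R) (c : T -> R) (f g : T -> W) t :
  {for t, continuous c} -> {for t, continuous f} -> {for t, continuous g} ->
  (c t = 0 -> f t = g t) ->
  {for t, continuous (fun s => if 0 <= c s then f s else g s)}.
Proof.
move=> cc cf cg fg; have [ct|ct|ct] := ltrgt0P (c t).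
- apply: near_continuous_at cf.
  near=> s; suff /ltW -> : 0 < c s by [].
  by near: s; apply: (cvgr_gt _ cc).
- apply: near_continuous_at cg.
  near=> s; suff : c s < 0 by rewrite ltNge => /negbTE ->.
  by near: s; apply: (cvgr_lt _ cc).
- have {}fg := fg ct; rewrite /prop_for /continuous_at ct lexx.
  apply/cvgrPdist_lt => e e0.
  near=> s; case: ifP => _.
    by near: s; move/cvgrPdist_lt : cf; apply.
  by rewrite fg; near: s; move/cvgrPdist_lt : cg; apply.
Unshelve. all: by end_near. Qed.

Lemma continuous_comp_within (T U W : topologicalType) (A : set U)
    (g : T -> U) (f : U -> W) (t : T) :
  {within A, continuous f} -> {for t, continuous g} ->
  (\forall s \near t, A (g s)) -> {for t, continuous (fun s => f (g s))}.
Proof.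
move=> /subspace_continuousP cf cg Ag.
have At : A (g t) := nbhs_singleton Ag.
apply: cvg_comp (cf _ At) => X; rewrite /within /= => /cg gX.
by apply: filterS2 gX Ag => s; exact.
Qed.

Lemma near_ball_norm (R : realType) (V : normedModType R) (p : V) (P : set V) :
  (\forall q \near p, P q) -> exists2 d, 0 < d & forall q, `|q - p| < d -> P q.
Proof.
move=> /nbhs_ballP[d d0 dP]; exists d => // q qp; apply: dP.
by rewrite -ball_normE /= distrC.
Qed.

Lemma norm_coord_le (R : realType) (n : nat) (x : 'rV[R]_n.+1) i : `|x 0 i| <= `|x|.
Proof.
rewrite [leRHS]/Num.norm/= mx_normrE.
exact: (le_bigmax _ (fun j => `|x j.1 j.2|) (0, i)).
Qed.

Lemma norm_le_coord (R : realType) (n : nat) (x : 'rV[R]_n.+1) (c : R) :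
  0 <= c -> (forall i, `|x 0 i| <= c) -> `|x| <= c.
Proof.
move=> c0 xc; rewrite [leLHS]/Num.norm/= mx_normrE; apply/bigmax_leP.
by split=> //= -[i j] _ /=; rewrite ord1.
Qed.

Lemma continuous_coord (R : realType) (T : topologicalType) (n : nat)
    (f : T -> 'rV[R]_n.+1) (t : T) (i : 'I_n.+1) :
  {for t, continuous f} -> {for t, continuous (fun s => f s 0 i)}.
Proof. move=> cf; have := @coord_continuous R 1 n.+1 0 i (f t); exact: cvg_comp. Qed.

Lemma continuous_row (R : realType) (T : topologicalType) (n : nat)
    (f : T -> 'rV[R]_n.+1) (t : T) :
  (forall i, {for t, continuous (fun s => f s 0 i)}) -> {for t, continuous f}.
Proof.
move=> cf; apply/cvgrPdist_lt => e e0.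
have e2 : 0 < e / 2 by rewrite divr_gt0.
near=> s.
apply: (@le_lt_trans _ _ (e / 2)); last by rewrite ltr_pdivrMr // ltr_pMr // ltr1n.
apply: norm_le_coord => [|i]; first exact: ltW.
rewrite !mxE; apply: ltW; move: i; near: s.
apply: filter_forall => i.
by have /cvgrPdist_lt/(_ _ e2) := cf i.
Unshelve. all: by end_near. Qed.

(** * Zeros of maps that are the identity far away *)

(** Heine's argument; [Q p d] stands for a property of the ball of radius [d]
around [p]. *)
Lemma compact_uniform_radius (R : realType) (V : normedModType R)
    (A : set V) (Q : V -> R -> Prop) :
  compact A ->
  (forall p d d', d' <= d -> Q p d -> Q p d') ->
  (forall p, A p -> exists2 d, 0 < d & forall q, `|q - p| < d -> Q q d) ->
  exists2 d, 0 < d & forall p, A p -> Q p d.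
Proof.
move=> /compact_near_coveringP cA Qmono Qloc.
have /= := cA R (0^'+) (fun d q => Q q d) _.
case=> [p /Qloc[d d0 Qd]|e /= e0 He].
  near=> q r => /=; apply: (Qmono _ d).
    by apply/ltW; near: r; apply: nbhs_right_lt.
  apply: Qd; rewrite distrC; near: q.
  by apply/nbhs_ballP; exists d => // y; rewrite -ball_normE.
exists (e / 2); first by rewrite divr_gt0.
move=> p; apply: He; last by rewrite divr_gt0.
by rewrite /= sub0r normrN gtr0_norm ?divr_gt0// gtr_pMr// invf_lt1 ?ltr1n.
Unshelve. all: by end_near. Qed.

(** A form of Brouwer's theorem.  Without zeros, compactness gives a radius [d]
such that on each ball of radius [d] some coordinate of [G] keeps its sign.
This contradicts [cubical_sperner] for the signs of the coordinates of [G] on a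
grid of mesh less than [d] in the cube of radius [K]: on the boundary of that
cube [G] is the identity, which gives the required boundary values. *)
Lemma zero_of_identity_far (R : realType) (n : nat)
    (G : 'rV[R]_n.+1 -> 'rV[R]_n.+1) (K : R) : 0 < K ->
  continuous G -> (forall x, K <= `|x| -> G x = x) -> exists x, G x = 0.
Proof.
move=> K0 cG Gid; apply/not_existsP => G0.
pose Q (p : 'rV[R]_n.+1) (d : R) := exists i, forall q r,
  `|q - p| < d -> `|r - p| < d -> 0 < G q 0 i -> 0 < G r 0 i.
have [d d0 Qd] : exists2 d, 0 < d & forall p, `|p| <= K -> Q p d.
  apply: (@compact_uniform_radius _ _ [set p | `|p| <= K]).
  - apply: bounded_closed_compact.
      exists K; split; first exact: num_real.
      by move=> x Kx y /= yK; apply: (le_trans yK); apply: ltW.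
    have -> : [set p : 'rV[R]_n.+1 | `|p| <= K] = closed_ball (0 : 'rV[R]_n.+1) K.
      rewrite closed_ballE //; apply/seteqP.
      by split => x /=; rewrite /closed_ball_ /= sub0r normrN.
    exact: closed_ball_closed.
  - move=> p e e' ee' [i Qi]; exists i => q r qp rp; apply: Qi; exact: lt_le_trans ee'.
  - move=> p _.
    have [i Gpi] : exists i, G p 0 i != 0.
      apply/existsP; apply: contra_notT (G0 p) => /existsPn Gp.
      by apply/rowP => i; rewrite mxE; apply/eqP; have := Gp i; rewrite negbK.
    have cGi : {for p, continuous (fun q => G q 0 i)}.
      by apply: continuous_coord; apply: cG.
    have [e e0 He] : exists2 e, 0 < e &
        forall q, `|q - p| < e -> (0 < G q 0 i) = (0 < G p 0 i).
      apply: near_ball_norm; have [Gp|Gp] := ltP 0 (G p 0 i).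
        by near=> q; near: q; apply: (cvgr_gt _ cGi).
      near=> q; apply/negbTE; rewrite -leNgt; apply/ltW; near: q.
      by apply: (cvgr_lt _ cGi); rewrite lt_neqAle Gpi.
    exists (e / 2); first by rewrite divr_gt0.
    move=> q qp; exists i => r s rq sq.
    have tri t : `|t - q| < e / 2 -> `|t - p| < e.
      move=> tq; rewrite -(subrK q t) -addrA (splitr e).
      by rewrite (le_lt_trans (ler_normD _ _)) ?ltrD.
    by rewrite !He ?tri.
have [N Nd] : exists N : nat, K *+ 2 / N.+1%:R < d.
  have Kd : 0 <= K *+ 2 / d by rewrite divr_ge0 ?mulrn_wge0 ?ltW.
  exists (Num.bound (K *+ 2 / d)).
  rewrite ltr_pdivrMr ?ltr0n // mulrC -ltr_pdivrMr //.
  by apply: lt_le_trans (archi_boundP Kd) _; rewrite ler_nat leqnSn.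
pose pt (y : {ffun 'I_n.+1 -> 'I_N.+2}) : 'rV[R]_n.+1 :=
  \row_i (- K + K *+ 2 / N.+1%:R * (y i)%:R).
have N0 : (0 : R) < N.+1%:R by rewrite ltr0n.
have ptK y i : `|pt y 0 i| = K -> G (pt y) 0 i = pt y 0 i.
  by move=> yK; rewrite Gid // -yK norm_coord_le.
have [||x Hx] := @cubical_sperner n.+1 N (fun i y => 0 < G (pt y) 0 i).
- move=> i y yi; have pti : pt y 0 i = - K by rewrite mxE yi mulr0 addr0.
  by rewrite ptK pti ?normrN ?gtr0_norm // oppr_gt0 -leNgt ltW.
- move=> i y yi; have pti : pt y 0 i = K.
    by rewrite mxE yi divfK ?gt_eqF // mulr2n addKr.
  by rewrite ptK pti ?gtr0_norm.
have step0 : 0 <= K *+ 2 / N.+1%:R by rewrite divr_ge0 ?mulrn_wge0 ?ltW.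
have [|i Hi] := Qd (pt x).
  apply: norm_le_coord => [|i]; first exact: ltW.
  rewrite mxE ler_norml; apply/andP; split; first by rewrite lerDl mulr_ge0.
  rewrite -lerBrDl opprK -mulr2n -[leRHS](divfK (lt0r_neq0 N0)).
  by rewrite ler_wpM2l // ler_nat -ltnS.
have [y [z [Gy Gz yz]]] := Hx i.
have close w : w \in [:: y; z] -> `|pt w - pt x| < d.
  move=> /yz xw; apply: le_lt_trans Nd; apply: norm_le_coord => // k.
  rewrite !mxE opprD opprK addrACA addNr add0r -mulrBr normrM ger0_norm //.
  rewrite ler_piMr // -natrB; last by case/andP: (xw k).
  rewrite normr_nat lern1 leq_subLR addn1.
  by case/andP: (xw k).
by move: Gz; rewrite (Hi (pt y) (pt z)) ?close // !inE eqxx ?orbT.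
Unshelve. all: by end_near. Qed.

(** * Orthogonal projections onto a continuous family of lines *)

Section LineProjection.
Variables (R : realType) (n : nat).
Local Notation V := 'rV[R]_n.+1.
Implicit Types (w x y z : V).

Definition dot x y : R := \sum_i x 0 i * y 0 i.

Lemma dotC x y : dot x y = dot y x.
Proof. by apply: eq_bigr => i _; rewrite mulrC. Qed.

Lemma dotZl a x y : dot (a *: x) y = a * dot x y.
Proof. by rewrite mulr_sumr; apply: eq_bigr => i _; rewrite mxE mulrA. Qed.

Lemma dotZr a x y : dot x (a *: y) = a * dot x y.
Proof. by rewrite dotC dotZl dotC. Qed.

Lemma dot_ge0 x : 0 <= dot x x.
Proof. by apply: sumr_ge0 => i _; rewrite -expr2 sqr_ge0. Qed.

Lemma dot_eq0 x : (dot x x == 0) = (x == 0).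
Proof.
rewrite /dot psumr_eq0; last by move=> i _; rewrite -expr2 sqr_ge0.
apply/allP/eqP => [x0|-> i _]; last by rewrite mxE mul0r eqxx.
apply/rowP => i; rewrite mxE; apply/eqP.
by have := x0 i (mem_index_enum _); rewrite mulf_eq0 orbb.
Qed.

Lemma dot_gt0 x : (0 < dot x x) = (x != 0).
Proof. by rewrite lt0r dot_ge0 andbT dot_eq0. Qed.

Lemma enormE x : enorm x = Num.sqrt (dot x x).
Proof. by congr Num.sqrt; apply: eq_bigr => i _; rewrite expr2. Qed.

Lemma sqr_enorm x : enorm x ^+ 2 = dot x x.
Proof. by rewrite enormE sqr_sqrtr ?dot_ge0. Qed.

Lemma enorm_ge0 x : 0 <= enorm x.
Proof. by rewrite enormE sqrtr_ge0. Qed.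

Lemma enorm_gt0 x : (0 < enorm x) = (x != 0).
Proof. by rewrite enormE sqrtr_gt0 dot_gt0. Qed.

Lemma enormZ a x : enorm (a *: x) = `|a| * enorm x.
Proof. by rewrite !enormE dotZl dotZr mulrA -expr2 sqrtrM ?sqr_ge0 // sqrtr_sqr. Qed.

Lemma continuous_dot (T : topologicalType) (f g : T -> V) t :
  {for t, continuous f} -> {for t, continuous g} ->
  {for t, continuous (fun t' => dot (f t') (g t'))}.
Proof.
move=> cf cg; apply: (@continuous_sum R T R^o) => i.
by apply: continuousM; apply: continuous_coord.
Qed.

Lemma continuous_enorm (T : topologicalType) (f : T -> V) t :
  {for t, continuous f} -> {for t, continuous (fun t' => enorm (f t'))}.
Proof.
move=> cf; apply: (eq_continuous_at (fun t' => enormE (f t'))).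
apply: (@continuous_comp _ _ _ (fun t' => dot (f t') (f t')) Num.sqrt).
  exact: continuous_dot.
exact: sqrt_continuous.
Qed.

Definition line_proj w x : V := (dot x w / dot w w) *: w.

Lemma line_projZ w (k : R) x : k != 0 -> line_proj (k *: w) x = line_proj w x.
Proof.
move=> k0; have [->|w0] := eqVneq w 0; first by rewrite scaler0.
rewrite /line_proj dotZl !dotZr scalerA; congr (_ *: _).
have : dot w w != 0 by rewrite dot_eq0.
by move=> ww; field; rewrite k0 ww.
Qed.

Lemma line_proj_id w : line_proj w w = w.
Proof.
have [->|w0] := eqVneq w 0; first by rewrite /line_proj scaler0.
by rewrite /line_proj divff ?scale1r // dot_eq0.
Qed.

Lemma line_proj_eq0 w x : w != 0 -> (line_proj w x == 0) = (dot x w == 0).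
Proof.
move=> w0; rewrite scaler_eq0 (negbTE w0) orbF mulf_eq0 invr_eq0 dot_eq0.
by rewrite (negbTE w0) orbF.
Qed.

Lemma line_proj_sum w x : line_proj w x = \sum_i x 0 i *: line_proj w (delta_mx 0 i).
Proof.
have dotd i : dot (delta_mx 0 i) w = w 0 i.
  rewrite /dot (bigD1 i) //= big1 => [|j ji]; first by rewrite mxE !eqxx mul1r addr0.
  by rewrite mxE (negbTE ji) andbF mul0r.
rewrite /line_proj; under [RHS]eq_bigr do rewrite dotd scalerA mulrA.
by rewrite -scaler_suml mulr_suml.
Qed.

(** A family of lines, off the origin, given by arbitrary spanning vectors [u y].
These cannot be expected to be continuous in [y], but the orthogonal projections
onto the lines do not depend on their choice. *)
Definition continuous_line_field (u : V -> V) : Prop :=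
  forall y, y != 0 ->
    u y != 0 /\ forall x, {for y, continuous (fun z => line_proj (u z) x)}.

Lemma continuous_line_proj (u : V -> V) (T : topologicalType) (f g : T -> V) t :
  continuous_line_field u -> f t != 0 ->
  {for t, continuous f} -> {for t, continuous g} ->
  {for t, continuous (fun t' => line_proj (u (f t')) (g t'))}.
Proof.
move=> cu ft0 cf cg; apply: (eq_continuous_at (fun t' => line_proj_sum _ _)).
apply: continuous_sum => i; apply: continuousZ; first exact: continuous_coord.
have [_ /(_ (delta_mx 0 i)) cp] := cu _ ft0.
exact: (continuous_comp cf cp).
Qed.

End LineProjection.

(** * Sections of a line field *)

Section LineFieldLifting.
Variables (R : realType) (n : nat).
Local Notation V := 'rV[R]_n.+1.
Implicit Types (w x y z : V).
Variable u : V -> V.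
Hypothesis cu : continuous_line_field u.

(** The projections of [u y] onto the lines at two points close to [y] are both
close to [u y], hence not orthogonal; compactness makes this uniform. *)
Lemma line_field_overlap (A : set V) : compact A -> (forall y, A y -> y != 0) ->
  exists2 d, 0 < d & forall y z, A y -> `|z - y| < d -> dot (u y) (u z) != 0.
Proof.
move=> cA A0.
pose Q y d := forall z, `|z - y| < d -> dot (u y) (u z) != 0.
suff [d d0 Qd] : exists2 d, 0 < d & forall y, A y -> Q y d.
  by exists d => // y z /Qd; apply.
apply: compact_uniform_radius cA _ _ => [p d d' dd' Qp z zp|y Ay].
  by apply: Qp; apply: lt_le_trans dd'.
have y0 := A0 _ Ay; have uy0 := (cu y0).1.
pose f z := line_proj (u z) (u y).
have cf : {for y, continuous f} by exact: (cu y0).2.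
have cF : {for (y, y), continuous (fun q : V * V => dot (f q.1) (f q.2))}.
  have c1 : {for (y, y), continuous (@fst V V)} by exact: cvg_fst.
  have c2 : {for (y, y), continuous (@snd V V)} by exact: cvg_snd.
  apply: continuous_dot; first exact: (continuous_comp c1 cf).
  exact: (continuous_comp c2 cf).
have Fyy : dot (f y) (f y) != 0 by rewrite /f line_proj_id dot_eq0.
have [e e0 He] : exists2 e : R, 0 < e & forall q : V * V,
    ball (y, y) e q -> dot (f q.1) (f q.2) != 0.
  have := @cvgr_neq0 _ R^o _ _ (nbhs_filter (y, y)) _ _ cF Fyy.
  by move=> /nbhs_ballP[e e0 He]; exists e.
exists (e / 2); first by rewrite divr_gt0.
move=> p py z zp.
have := He (p, z); rewrite /f /line_proj /= dotZl dotZr.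
have H : (ball (y,y) e) (p, z).
  split; rewrite /= -ball_normE /= distrC.
    by rewrite (lt_le_trans py) // ler_pdivrMr // ler_pMr // ler1n.
  rewrite -(subrK p z) -addrA (splitr e).
  by rewrite (le_lt_trans (ler_normD _ _)) ?ltrD.
by move=> /(_ H); apply: contra_neq => ->; rewrite !mulr0.
Qed.

(** Divide the segment from [w] to [y] into [N] short steps and project a vector
of the line at [w] successively onto the lines met.  The result depends
continuously on [y], and it does not vanish because consecutive lines are not
orthogonal.  The bounds on the norm keep the segments in a compact set that
avoids the origin. *)
Lemma line_field_star_section (w : V) (E : set V) :
  (forall y t, E y -> 0 <= t <= 1 -> 3^-1 <= `|(1 - t) *: w + t *: y| <= 1) ->
  exists v : V -> V, forall y, E y ->
    [/\ {for y, continuous v}, v y != 0 & exists k, v y = k *: u y].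
Proof.
move=> Ew.
pose A := [set y : V | 3^-1 <= `|y| <= 1].
have A0 y : A y -> y != 0.
  move=> /andP[+ _]; apply: contraTN => /eqP ->; rewrite normr0.
  by rewrite -ltNge invr_gt0.
have cA : compact A.
  apply: bounded_closed_compact.
    exists 1; split; first exact: num_real.
    by move=> x x1 y /andP[_ y1]; apply: (le_trans y1); apply: ltW.
  have cn := @norm_continuous R V.
  have -> : A = (fun y => `|y|) @^-1` [set r | 3^-1 <= r]
      `&` (fun y => `|y|) @^-1` [set r | r <= 1].
    by apply/seteqP; split=> y /= => [/andP[]//|[]]; rewrite /A /= => -> ->.
  apply: closedI; apply: closed_comp => [x _|].
  - exact: cn.
  - exact: closed_ge.
  - exact: cn.
  - exact: closed_le.
have [d d0 Hd] := line_field_overlap cA A0.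
pose N := (Num.bound (2 / d)).+1.
have N0 : (0 : R) < N%:R by rewrite ltr0n.
have Nd : 2 / N%:R < d.
  have d2 : 0 <= 2 / d by rewrite divr_ge0 // ltW.
  rewrite ltr_pdivrMr // mulrC -ltr_pdivrMr //.
  by apply: lt_le_trans (archi_boundP d2) _; rewrite ler_nat leqnSn.
pose path k y : V := (1 - k%:R / N%:R) *: w + (k%:R / N%:R) *: y.
have path0 y : path 0%N y = w by rewrite /path mul0r subr0 scale1r scale0r addr0.
have pathN y : path N y = y by rewrite /path divff ?gt_eqF // subrr scale1r scale0r add0r.
have pathA k y : E y -> (k <= N)%N -> A (path k y).
  move=> Ey kN; apply: Ew => //; rewrite divr_ge0 //= ler_pdivrMr // mul1r ler_nat //.
have cpath k y : {for y, continuous (path k)}.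
  apply: continuous_add; first exact: continuous_at_cst.
  by apply: continuous_scale; first exact: continuous_at_cst.
have pathS k y : E y -> `|path k.+1 y - path k y| < d.
  move=> Ey; apply: le_lt_trans Nd.
  have -> : path k.+1 y - path k y = N%:R^-1 *: (y - w).
    by apply/rowP => i; rewrite !mxE -(natr1 k); field; rewrite gt_eqF.
  rewrite normrZ gtr0_norm ?invr_gt0 // mulrC ler_pM2r ?invr_gt0 //.
  rewrite (le_trans (ler_normB _ _)) // lerD //.
    have := pathA N y Ey (leqnn N); rewrite pathN; by case/andP.
  by have := pathA 0%N y Ey (leq0n N); rewrite path0; case/andP.
pose L := fix L k y := if k is k'.+1 then line_proj (u (path k y)) (L k' y) else u w.
have HL k y : E y -> (k <= N)%N ->
    [/\ {for y, continuous (L k)}, L k y != 0 & exists c, L k y = c *: u (path k y)].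
  move=> Ey; elim: k => [_|k IH kN].
    split; [exact: continuous_at_cst| |by exists 1; rewrite path0 scale1r].
    by rewrite /= -(path0 y); apply: (cu _).1; apply/A0/pathA.
  have [cL L0 [c Lc]] := IH (ltnW kN).
  have pS0 : path k.+1 y != 0 by apply/A0/pathA.
  split; last by eexists; reflexivity.
    exact: (continuous_line_proj cu pS0 (@cpath k.+1 y) cL).
  rewrite /= line_proj_eq0; last exact: (cu pS0).1.
  rewrite Lc dotZl mulf_neq0 //.
    by apply: contra_neq L0; rewrite Lc => ->; rewrite scale0r.
  by apply: Hd; [exact: pathA (ltnW kN)|exact: pathS].
exists (L N) => y Ey; have := HL N y Ey (leqnn _).
by rewrite pathN.
Qed.
End LineFieldLifting.
Section SphereSection.
Variables (R : realType) (n : nat).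
Local Notation V := 'rV[R]_n.+1.
Implicit Types (w x y z : V).
Variable u : V -> V.
Hypothesis cu : continuous_line_field u.
Hypothesis u_cone : forall (k : R) y, 0 < k -> u (k *: y) = u y.

(** [line_field_star_section] applies with the pole [w] of sign [s] to the points
[y] of its hemisphere.  Reflecting the other hemisphere onto this one makes the
section continuous everywhere; it is normalised so that the sections over the
two hemispheres can be compared on the equator. *)
Lemma hemisphere_section (s : R) : s ^+ 2 = 1 ->
  exists v : V -> V, forall y, y != 0 ->
    [/\ {for y, continuous v}, enorm (v y) = 1 &
        0 <= s * y 0 0 -> exists k, v y = k *: u y].
Proof.
move=> s2; have ns : `|s| = 1.
  by apply/eqP; rewrite -(@eqrXn2 _ 2) // ?normr_ge0 // expr1n real_normK ?num_real // s2.
have s0 : s != 0 by rewrite -normr_gt0 ns ltr01.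
pose w : V := s *: delta_mx 0 0.
pose E := [set y : V | `|y| = 1 /\ 0 <= s * y 0 0].
have w1 : `|w| <= 1.
  apply: norm_le_coord => // i; rewrite !mxE normrM ns mul1r normr_nat.
  by case: (_ && _); rewrite ?ler01.
have [|L HL] := @line_field_star_section R n u cu w E.
  move=> y t [y1 y0] /andP[t0 t1]; set x := _ + _.
  have tE : `|t *: y| = t by rewrite normrZ y1 mulr1 ger0_norm.
  have tw : `|(1 - t) *: w| <= 1 - t.
    by rewrite normrZ ger0_norm ?subr_ge0 // ler_piMr // subr_ge0.
  have x1 : 1 - t <= `|x|.
    have xs : s * x 0 0 <= `|x|.
      by rewrite (le_trans (ler_norm _)) // normrM ns mul1r norm_coord_le.
    apply: le_trans xs; rewrite !mxE !eqxx mulr1 mulrDr mulrCA -expr2 s2 mulr1.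
    by rewrite mulrCA lerDl mulr_ge0.
  have x2 : t - (1 - t) <= `|x|.
    rewrite lerBlDr -[leLHS]tE (_ : t *: y = x - (1 - t) *: w); last first.
      by rewrite /x addrC addKr.
    by apply: le_trans (ler_normB _ _) _; rewrite lerD2l.
  (* Twice the first bound plus the second one. *)
  apply/andP; split; first lra.
  by apply: le_trans (ler_normD _ _) _; rewrite tE; lra.
pose fold y : V := \row_i (if i == 0 then s * `|y 0 0| else y 0 i).
have fold_eq0 y : y != 0 -> fold y != 0.
  apply: contra_neq => fy0; apply/rowP => i; have := congr1 (fun z : V => z 0 i) fy0.
  rewrite !mxE; case: eqVneq => [->|//] /eqP.
  by rewrite mulf_eq0 (negbTE s0) normr_eq0 => /eqP.
have cfold y : {for y, continuous fold}.
  apply: continuous_row => i; apply: (eq_continuous_at (fun z => mxE _ _ _ _)).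
  have [_|_] := eqVneq i 0; last exact: coord_continuous.
  apply: continuousM; first exact: continuous_at_cst.
  apply: (@continuous_comp _ _ _ (fun z : V => z 0 0) Num.norm).
    exact: coord_continuous.
  exact: norm_continuous.
pose g y : V := `|fold y|^-1 *: fold y.
have cg y : y != 0 -> {for y, continuous g}.
  move=> /fold_eq0 fy; apply: continuous_scale; last exact: cfold.
  apply: continuousV; first by rewrite normr_eq0.
  apply: (@continuous_comp _ _ _ fold Num.norm); first exact: cfold.
  exact: norm_continuous.
have Eg y : y != 0 -> E (g y).
  move=> /fold_eq0 fy; split.
    by rewrite normrZ normfV normr_id mulVf // normr_eq0.
  by rewrite !mxE eqxx mulrCA mulr_ge0 // ?invr_ge0 // mulrA -expr2 s2 mul1r.
have cLg y : y != 0 -> {for y, continuous (fun z => L (g z))}.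
  move=> y0; have [cL _ _] := HL _ (Eg _ y0); exact: (continuous_comp (cg _ y0) cL).
exists (fun y => (enorm (L (g y)))^-1 *: L (g y)) => y y0.
have [_ L0 [k Lk]] := HL _ (Eg _ y0).
have eL : enorm (L (g y)) != 0 by rewrite gt_eqF // enorm_gt0.
split.
- apply: continuous_scale; last exact: cLg.
  apply: continuousV => //; apply: continuous_enorm; exact: cLg.
- by rewrite enormZ ger0_norm ?invr_ge0 ?enorm_ge0 // mulVf.
- move=> sy; have fy : fold y = y.
    apply/rowP => i; rewrite mxE; case: eqVneq => // ->.
    by rewrite -[`|_|]mul1r -ns -normrM ger0_norm // mulrA -expr2 s2 mul1r.
  exists ((enorm (L (g y)))^-1 * k); rewrite -scalerA [X in _ *: X]Lk.
  by rewrite /g fy u_cone // invr_gt0 normr_gt0.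
Qed.

(** The equator [y 0 0 = 0] is connected when [1 < n].  Concretely, [f] keeps its
sign along segments of the equator avoiding the origin, and every point is
joined by such segments to the coordinate vector of index 1, if need be through
that of index 2. *)
Lemma equator_same_sign (f : V -> R) : (1 < n)%N ->
  (forall y, y != 0 -> {for y, continuous f}) ->
  (forall y, y != 0 -> y 0 0 = 0 -> f y != 0) ->
  exists e : R, e ^+ 2 = 1 /\ forall y, y != 0 -> y 0 0 = 0 -> 0 < e * f y.
Proof.
move=> n1 cf f0.
pose same p q := 0 < f p * f q.
have same_trans p q r : same p q -> same q r -> same p r.
  rewrite /same => pq qr; have qq : 0 < f q ^+ 2.
    rewrite lt0r sqr_ge0 andbT sqrf_eq0.
    by apply: contraTN pq => /eqP ->; rewrite mulr0 ltxx.
  by have := mulr_gt0 pq qr; rewrite mulrACA [f q * _]mulrC -mulrACA -expr2 pmulr_lgt0.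
have segment (p q : V) : (forall t : R, 0 <= t <= 1 -> (1 - t) *: p + t *: q != 0) ->
    p 0 0 = 0 -> q 0 0 = 0 -> same p q.
  move=> pq p0 q0; rewrite /same ltNge; apply/negP => fpq.
  pose h t := f ((1 - t) *: p + t *: q).
  have [||t t01 ht] := @IVT R h 0 1 0 ler01.
  - apply: continuous_in_subspaceT => t; rewrite inE /= in_itv /= => /pq x0.
    apply: (@continuous_comp _ _ _ (fun t : R => (1 - t) *: p + t *: q) f);
      last exact: cf.
    apply: continuous_add; apply: continuous_scale; try exact: continuous_at_cst.
      by apply: continuousB; [exact: continuous_at_cst|exact: cvg_id].
    exact: cvg_id.
  - rewrite /h subr0 scale1r scale0r addr0 subrr scale0r add0r scale1r.
    rewrite ge_min le_max.
    have [fp|fp] := leP (f p) 0 => /=.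
      have [//|fq] := leP 0 (f q); first by rewrite orbT.
      rewrite orbF leNgt; apply/negP => fp'.
      by move: fpq; rewrite leNgt nmulr_rgt0 ?fq.
    rewrite (ltW fp) andbT leNgt; apply/negP => fq.
    by have := mulr_gt0 fp fq; rewrite ltNge fpq.
  - move: t01; rewrite in_itv /= => t01.
    have x0 : ((1 - t) *: p + t *: q) 0 0 = 0 by rewrite !mxE p0 q0 !mulr0 addr0.
    by have := f0 _ (pq t t01) x0; rewrite -/(h t) ht eqxx.
pose d k : V := delta_mx 0 k.
have d_neq0 k : d k != 0.
  apply/eqP => /rowP/(_ k)/eqP; rewrite !mxE !eqxx; apply/negP; exact: oner_neq0.
have d0 k : k != 0 -> d k 0 0 = 0.
  by move=> k0; rewrite mxE eqxx eq_sym (negbTE k0).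
have to_axis (p : V) k l : p 0 k != 0 -> p 0 0 = 0 -> l != 0 -> l != k -> same p (d l).
  move=> pk p0 l0 lk; apply: segment => //; last exact: d0.
  move=> t _; apply/eqP => /rowP x0.
  have := x0 k; rewrite !mxE [k == l]eq_sym (negbTE lk) andbF mulr0n mulr0 addr0 => /eqP.
  rewrite mulf_eq0 (negbTE pk) orbF subr_eq0 => /eqP t1.
  have := x0 l; rewrite !mxE !eqxx -t1 subrr mul0r add0r mulr1 => /eqP.
  by rewrite oner_eq0.
pose i1 : 'I_n.+1 := inord 1; pose i2 : 'I_n.+1 := inord 2.
have i10 : i1 != 0 by rewrite -val_eqE /= inordK // ltnS ltnW.
have i20 : i2 != 0 by rewrite -val_eqE /= inordK.
have i12 : i1 != i2 by rewrite -val_eqE /= !inordK // ltnS ltnW.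
have all_same (p : V) : p != 0 -> p 0 0 = 0 -> same p (d i1).
  move=> pn0 p0; have [k pk] : exists k, p 0 k != 0.
    apply/existsP; apply: contraNT pn0 => /existsPn pk.
    by apply/eqP/rowP => k; rewrite mxE; apply/eqP; have := pk k; rewrite negbK.
  have [ki|ki] := eqVneq i1 k; last exact: to_axis ki.
  apply: (@same_trans _ (d i2)); first by apply: (to_axis p k); rewrite // -ki eq_sym.
  by apply: (to_axis (d i2) i2) => //; [rewrite mxE !eqxx oner_neq0|apply: d0].
exists (Num.sg (f (d i1))); split.
  by rewrite sqr_sg f0 ?d0.
move=> y y0 yy; have := all_same y y0 yy; rewrite /same => H.
by rewrite -sgr_gt0 sgrM sgr_id -sgrM mulrC sgr_gt0.
Qed.

(** The sections over the two hemispheres are glued along the equator, after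
multiplying one of them by the constant sign [e] that relates them there. *)
Lemma sphere_line_field_section : (1 < n)%N ->
  exists v : V -> V, forall y, y != 0 ->
    [/\ {for y, continuous v}, v y != 0 & exists k, v y = k *: u y].
Proof.
move=> n1.
have [f Hf] := hemisphere_section (expr1n _ 2).
have [|g Hg] := @hemisphere_section (-1); first by rewrite sqrrN expr1n.
have [||e [e2 He]] := @equator_same_sign (fun y => dot (f y) (g y)) n1.
- move=> y y0; have [cf _ _] := Hf y y0; have [cg _ _] := Hg y y0.
  exact: continuous_dot.
- move=> y y0 yy; have [_ f1 [|a fa]] := Hf y y0; first by rewrite yy mulr0.
  have [_ g1 [|b gb]] := Hg y y0; first by rewrite yy mulr0.
  have uy : u y != 0 := (cu y0).1.
  have k0 (x : V) k : enorm x = 1 -> x = k *: u y -> k != 0.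
    move=> x1 xk; apply: contra_eq_neq x1 => k0.
    by rewrite xk k0 enormZ normr0 mul0r eq_sym oner_neq0.
  by rewrite fa gb dotZl dotZr !mulf_neq0 ?dot_eq0 // ?(k0 _ _ f1 fa) ?(k0 _ _ g1 gb).
have e0 : e != 0 by rewrite -sqrf_eq0 e2 oner_neq0.
exists (fun y => if 0 <= y 0 0 then f y else e *: g y) => y y0.
have [cf f1 Hfy] := Hf y y0; have [cg g1 Hgy] := Hg y y0.
have neq0 (x : V) : enorm x = 1 -> x != 0.
  by rewrite -enorm_gt0 => ->.
split.
- have cc : {for y, continuous (fun z : V => z 0 0)} by exact: coord_continuous.
  have ceg : {for y, continuous (fun z => e *: g z)}.
    by apply: continuous_scale => //; exact: continuous_at_cst.
  apply: (continuous_glue cc cf ceg) => yy.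
  have [|a fa] := Hfy; first by rewrite yy mulr0.
  have [|b gb] := Hgy; first by rewrite yy mulr0.
  have dot1 (x : V) k : enorm x = 1 -> x = k *: u y -> k * (k * dot (u y) (u y)) = 1.
    by move=> x1 xk; rewrite -[RHS](expr1n _ 2) -x1 sqr_enorm xk dotZl dotZr.
  have a1 := dot1 _ _ f1 fa; have b1 := dot1 _ _ g1 gb.
  have D0 : 0 < dot (u y) (u y) by rewrite dot_gt0; apply: (cu y0).1.
  have := He y y0 yy; rewrite fa gb dotZl dotZr scalerA => eab.
  (* Two unit vectors of a line agree up to a sign, which is [e]. *)
  have : (a - e * b) * (a + e * b) = 0.
    apply: (mulIf (lt0r_neq0 D0)); rewrite mul0r.
    transitivity (a * (a * dot (u y) (u y))
        - e ^+ 2 * (b * (b * dot (u y) (u y)))); first ring.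
    by rewrite a1 b1 e2 mul1r subrr.
  move/eqP; rewrite mulf_eq0 subr_eq0 addr_eq0 => /orP[/eqP -> //|/eqP ae].
  move: eab; rewrite ae ltNge => /negP[].
  have -> : e * (- (e * b) * (b * dot (u y) (u y)))
      = - (e ^+ 2 * (b * (b * dot (u y) (u y)))) by ring.
  by rewrite e2 b1 mulr1 oppr_le0 ler01.
- by case: ifP => _; [exact: neq0|rewrite scaler_eq0 (negbTE e0) neq0].
- case: (leP 0 (y 0 0)) => yy; first by apply: Hfy; rewrite mul1r.
  have [|b gb] := Hgy; first by rewrite mulN1r oppr_ge0 ltW.
  by exists (e * b); rewrite gb scalerA.
Qed.
End SphereSection.
(** For [n = 1] the line field may be a Moebius band, and for it to have a section
one needs a field [x] transversal to the lines: the quarter turn [J x] is then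
never orthogonal to them.  For [n = 0] no line misses any vector. *)
Lemma transversal_line_section (R : realType) (n : nat)
    (u x : 'rV[R]_n.+1 -> 'rV[R]_n.+1) :
  continuous_line_field u ->
  (forall (k : R) y, 0 < k -> u (k *: y) = u y) ->
  (forall y, y != 0 -> {for y, continuous x}) ->
  (forall y k, y != 0 -> x y != k *: u y) ->
  exists v : 'rV[R]_n.+1 -> 'rV[R]_n.+1, forall y, y != 0 ->
    [/\ {for y, continuous v}, v y != 0 & exists k, v y = k *: u y].
Proof.
case: n u x => [|[|n]] u x cu u_cone cx xu; last exact: sphere_line_field_section.
  exists x => y y0; have uy := (cu y y0).1.
  have u0 : u y 0 0 != 0.
    by apply: contra_neq uy => u0; apply/rowP => i; rewrite ord1 mxE.
  have /eqP[] := xu y (x y 0 0 / u y 0 0) y0.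
  by apply/rowP => i; rewrite ord1 !mxE divfK.
pose J (z : 'rV[R]_2) : 'rV[R]_2 := \row_i (if i == 0 then - z 0 1 else z 0 0).
have J_parallel z w : w != 0 -> dot (J z) w = 0 -> exists k, z = k *: w.
  move=> w0; rewrite /dot !big_ord_recl big_ord0 addr0 !mxE /= => zw.
  have l1 : lift ord0 ord0 = 1 :> 'I_2 by apply/val_inj.
  rewrite l1 in zw; have {}zw : z 0 0 * w 0 1 = z 0 1 * w 0 0.
    by apply/eqP; rewrite -subr_eq0 addrC -mulNr; apply/eqP.
  have row2P (p q : 'rV[R]_2) : p 0 0 = q 0 0 -> p 0 1 = q 0 1 -> p = q.
    move=> p0 p1; apply/rowP => i; have [->//|i0] := eqVneq i 0.
    suff -> : i = 1 by [].
    by apply/val_inj; case: i i0 => [[|[|]]].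
  have [w00|w00] := eqVneq (w 0 0) 0.
    have w01 : w 0 1 != 0.
      by apply: contra_neq w0 => w01; apply: row2P; rewrite mxE.
    exists (z 0 1 / w 0 1); apply: row2P; rewrite !mxE ?divfK //.
    by apply: (mulIf w01); rewrite zw w00 !mulr0 mul0r.
  exists (z 0 0 / w 0 0); apply: row2P; rewrite !mxE ?divfK //.
  by rewrite mulrAC zw mulfK.
exists (fun y => line_proj (u y) (J (x y))) => y y0; have uy := (cu y y0).1.
split; last by eexists; reflexivity.
- have cxi i : {for y, continuous (fun z => x z 0 i)}.
    by apply: continuous_coord; exact: cx.
  have cJ : {for y, continuous (fun z => J (x z))}.
    apply: continuous_row => i; apply: (eq_continuous_at (fun z => mxE _ _ _ _)).
    by case: (i == 0); [apply: continuousN; exact: cxi|exact: cxi].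
  exact: (continuous_line_proj cu (f := id) y0 (@continuous_at_id _ y) cJ).
- rewrite line_proj_eq0 //; apply/eqP => /(J_parallel _ _ uy)[k xk].
  by have := xu y k y0; rewrite xk eqxx.
Qed.

Lemma norm_le_enorm (R : realType) (n : nat) (x : 'rV[R]_n.+1) : `|x| <= enorm x.
Proof.
apply: norm_le_coord => [|i]; first exact: enorm_ge0.
rewrite -sqrtr_sqr ler_wsqrtr // (bigD1 i) //= lerDl.
by apply: sumr_ge0 => j _; exact: sqr_ge0.
Qed.

(** * No nowhere zero field is transversal to an inner and an outer point *)

(** Otherwise [zero_of_identity_far] is contradicted by the following map [G],
translated by [a].  With [th = 3 |y| / r], it runs through the homotopy from
[y - b] to [v] and then to [y - a] as [th] increases from 1 to 3.  It is [3 y - b] for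
[th <= 1], which has no zero since [b] is outside the sphere, and [y - a] for
[th >= 3], which has none since [a] is inside. *)
Lemma no_transversal_field (R : realType) (n : nat) (r : R) (a b : 'rV[R]_n.+1)
    (v : 'rV[R]_n.+1 -> 'rV[R]_n.+1) :
  0 < r -> enorm a < r -> r < enorm b ->
  (forall y, y != 0 -> {for y, continuous v} /\ v y != 0) ->
  exists2 y, enorm y = r & exists k, y - a = k *: v y \/ y - b = k *: v y.
Proof.
move=> r0 ar br cv; apply: contrapT => noy.
have ya y k : enorm y = r -> y - a = k *: v y -> False.
  by move=> yr yk; apply: noy; exists y => //; exists k; left.
have yb y k : enorm y = r -> y - b = k *: v y -> False.
  by move=> yr yk; apply: noy; exists y => //; exists k; right.
pose th (y : 'rV[R]_n.+1) := 3 * enorm y / r.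
pose l0 y := Num.min 1 (Num.max 0 (th y - 2)).
pose l2 y := Num.min 1 (Num.max 0 (2 - th y)).
(* The radial projection to the sphere for [th] between 1 and 3, prolonged
   continuously by [3 y] inside and by [y] outside. *)
pose pr (y : 'rV[R]_n.+1) : 'rV[R]_n.+1 :=
  (r / Num.max (r / 3) (Num.min (enorm y) r)) *: y.
pose G y : 'rV[R]_n.+1 :=
  l0 y *: (pr y - a) + (1 - l0 y - l2 y) *: v (pr y) + l2 y *: (pr y - b).
have enormE3 y : enorm y = th y / 3 * r by rewrite /th; field; rewrite gt_eqF.
have neq0 (y : 'rV[R]_n.+1) : 0 < enorm y -> y != 0 by rewrite enorm_gt0.
have G3 y : 3 <= th y -> G y = y - a.
  move=> y3; have ry : r <= enorm y by rewrite enormE3 ler_pMl // ler_pdivlMr // mul1r.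
  have pry : pr y = y by rewrite /pr (min_r ry) max_r ?divff ?scale1r ?gt_eqF //; lra.
  have l0y : l0 y = 1 by rewrite /l0 max_r ?min_l //; lra.
  have l2y : l2 y = 0 by rewrite /l2 max_l ?min_r //; lra.
  by rewrite /G pry l0y l2y subrr subr0 !scale0r !addr0 scale1r.
have pr_sphere y : 1 <= th y -> th y <= 3 -> enorm (pr y) = r.
  move=> y1 y3; have ey := enormE3 y.
  have yr : enorm y <= r by rewrite ey ler_piMl ?(ltW r0) // ler_pdivrMr // mul1r.
  have yr3 : r / 3 <= enorm y by rewrite ey mulrAC ler_pM2r ?invr_gt0 // ler_peMl // ltW.
  have y0 : 0 < enorm y by apply: lt_le_trans yr3; rewrite divr_gt0.
  rewrite /pr (min_l yr) (max_r yr3) enormZ ger0_norm ?divfK ?gt_eqF //.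
  by rewrite divr_ge0 ?ltW.
have G2 y : 2 <= th y -> th y <= 3 ->
    G y = (th y - 2) *: (pr y - a) + (3 - th y) *: v (pr y).
  move=> y2 y3; have l0y : l0 y = th y - 2 by rewrite /l0 max_r ?min_r //; lra.
  have l2y : l2 y = 0 by rewrite /l2 max_l ?min_r //; lra.
  by rewrite /G l0y l2y scale0r addr0; congr (_ + _ *: _); ring.
have G1 y : 1 <= th y -> th y <= 2 ->
    G y = (th y - 1) *: v (pr y) + (2 - th y) *: (pr y - b).
  move=> y1 y2; have l0y : l0 y = 0 by rewrite /l0 max_l ?min_r //; lra.
  have l2y : l2 y = 2 - th y by rewrite /l2 max_r ?min_r //; lra.
  by rewrite /G l0y l2y scale0r add0r; congr (_ *: _ + _); ring.
have G0 y : th y <= 1 -> G y = 3 *: y - b.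
  move=> y1; have l0y : l0 y = 0 by rewrite /l0 max_l ?min_r //; lra.
  have l2y : l2 y = 1 by rewrite /l2 max_r ?min_l //; lra.
  rewrite /G l0y l2y !subr0 subrr !scale0r !add0r scale1r; congr (_ - _).
  have yr3 : enorm y <= r / 3.
    by rewrite enormE3 mulrAC ler_pM2r ?invr_gt0 // ler_piMl // ltW.
  rewrite /pr max_l ?ge_min ?yr3 //; congr (_ *: _); field.
  by rewrite gt_eqF.
have solve (c k : R) (x w : 'rV[R]_n.+1) : c != 0 -> k *: w + c *: x = 0 ->
    x = (- (k / c)) *: w.
  move=> c0 /eqP; rewrite addrC addr_eq0 => /eqP cx.
  by rewrite -[x](scalerK c0) cx scalerN scaleNr scalerA mulrC.
have G_neq0 y : G y != 0.
  apply/eqP => Gy; have [y1|y1] := leP (th y) 1.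
    move: Gy; rewrite G0 // => /eqP; rewrite subr_eq0 => /eqP yb3.
    have : enorm b <= r.
      rewrite -yb3 enormZ ger0_norm // enormE3.
      have -> : 3 * (th y / 3 * r) = th y * r by field.
      by rewrite ler_piMl // ltW.
    by rewrite leNgt br.
  have [y3|y3] := leP (th y) 3; last first.
    move: Gy; rewrite G3 ?ltW // => /eqP; rewrite subr_eq0 => /eqP ya0.
    have := ar; rewrite -ya0 enormE3 gtr_pMl // ltr_pdivrMr // mul1r.
    by rewrite ltNge ltW.
  have pry := pr_sphere y (ltW y1) y3.
  have prn0 : pr y != 0 by rewrite neq0 // pry.
  have [_ /eqP vp] := cv _ prn0.
  have [y2|y2|y2] := ltrgtP (th y) 2.
  - apply: (yb _ _ pry); apply: (solve (2 - th y) (th y - 1)).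
      by rewrite subr_eq0 gt_eqF.
    by rewrite -G1 // ltW.
  - apply: (ya _ _ pry); apply: (solve (th y - 2) (3 - th y)).
      by rewrite subr_eq0 gt_eqF.
    by rewrite addrC -G2 // ltW.
  - apply: vp; move: Gy; rewrite G1 ?y2 // ?ler1n // subrr scale0r addr0.
    by rewrite (_ : 2 - 1 = 1) ?scale1r => [->//|]; ring.
have cth y : {for y, continuous th}.
  apply: continuousM; last exact: continuous_at_cst.
  apply: continuousM; first exact: continuous_at_cst.
  by apply: continuous_enorm; exact: continuous_at_id.
have cG : continuous G.
  move=> y; have [y1|y1] := ltP (th y) 1.
    have c3 : {for y, continuous (fun z : 'rV[R]_n.+1 => 3 *: z - b)}.
      apply: continuous_add; last exact: continuous_at_cst.
      by apply: continuous_scale; [exact: continuous_at_cst|exact: continuous_at_id].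
    apply: near_continuous_at c3; near=> z; rewrite G0 //; apply: ltW.
    by near: z; apply: (cvgr_lt _ (cth y)).
  have y0 : enorm y != 0.
    by apply: contraTN y1 => /eqP y0; rewrite /th y0 mulr0 mul0r -ltNge ltr01.
  have yn0 : y != 0 by rewrite neq0 // lt0r y0 enorm_ge0.
  have cn : {for y, continuous (@enorm R n.+1)}.
    by apply: continuous_enorm; exact: continuous_at_id.
  have cpr : {for y, continuous pr}.
    apply: continuous_scale; last exact: continuous_at_id.
    apply: continuousM; first exact: continuous_at_cst.
    apply: continuousV; first by rewrite gt_eqF // lt_max divr_gt0.
    apply: continuous_max; first exact: continuous_at_cst.
    by apply: continuous_min; [exact: cn|exact: continuous_at_cst].
  have prn0 : pr y != 0.
    rewrite scaler_eq0 negb_or yn0 andbT mulf_neq0 ?invr_eq0 ?gt_eqF //.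
    by rewrite lt_max divr_gt0.
  have cl0 : {for y, continuous l0}.
    apply: continuous_min; first exact: continuous_at_cst.
    apply: continuous_max; first exact: continuous_at_cst.
    by apply: continuousB; [exact: cth|exact: continuous_at_cst].
  have cl2 : {for y, continuous l2}.
    apply: continuous_min; first exact: continuous_at_cst.
    apply: continuous_max; first exact: continuous_at_cst.
    by apply: continuousB; [exact: continuous_at_cst|exact: cth].
  have cG0 : {for y, continuous (fun z => l0 z *: (pr z - a))}.
    apply: continuous_scale; first exact: cl0.
    by apply: continuous_add; [exact: cpr|exact: continuous_at_cst].
  have cG1 : {for y, continuous (fun z => (1 - l0 z - l2 z) *: v (pr z))}.
    apply: continuous_scale.
      apply: continuousB; last exact: cl2.
      by apply: continuousB; [exact: continuous_at_cst|exact: cl0].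
    have [cvp _] := cv _ prn0; exact: (continuous_comp cpr cvp).
  have cG2 : {for y, continuous (fun z => l2 z *: (pr z - b))}.
    apply: continuous_scale; first exact: cl2.
    by apply: continuous_add; [exact: cpr|exact: continuous_at_cst].
  exact: (continuous_add (continuous_add cG0 cG1) cG2).
have [|||x Gx] := @zero_of_identity_far R n (fun x : 'rV[R]_n.+1 => G (x + a)) (r + `|a|).
- by rewrite ltr_pwDl.
- move=> x; have cx : {for x, continuous (fun x : 'rV[R]_n.+1 => x + a)}.
    by apply: continuous_add; [exact: continuous_at_id|exact: continuous_at_cst].
  exact: (continuous_comp cx (cG _)).
- move=> x xr; rewrite G3 ?addrK // /th ler_pdivlMr // ler_pM2l //.
  apply: le_trans (norm_le_enorm _); rewrite -(lerD2r `|a|).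
  by apply: le_trans xr _; rewrite -{1}[x](addrK a) ler_normB.
- by have := G_neq0 (x + a); rewrite Gx eqxx.
Unshelve. all: by end_near. Qed.

(** * The direction of a point of projective space *)

Section LineDirection.
Variables (R : realType) (n : nat).
Local Notation V := 'rV[R]_n.+1.

(** A spanning vector of the line, chosen without any continuity. *)
Definition direction (l : projective_space R n) : V := vpick (line_of l).

Lemma direction_neq0 (l : projective_space R n) : direction l != 0.
Proof. exact: vpick_line_nonzero. Qed.

Lemma direction_scale_mem (l : projective_space R n) (k : R) :
  k *: direction l \in line_of l.
Proof. by rewrite memvZ ?memv_pick. Qed.

Lemma direction_pi (v : nonzero R n) :
  exists2 k : R, k != 0 & direction (\pi_(projective_space R n)%qT v) = k *: set_val v.
Proof.
set l := \pi_(projective_space R n)%qT v.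
have : direction l \in <[set_val v]>%VS by rewrite -line_of_pi memv_pick.
move=> /vlineP[k lk]; exists k => //; apply/eqP => k0.
by have := direction_neq0 l; rewrite lk k0 scale0r eqxx.
Qed.

(** By the universal property of the quotient topology it suffices to project onto
the span of a continuously varying nonzero vector. *)
Lemma continuous_direction (x : V) :
  continuous (fun l : projective_space R n => line_proj (direction l) x).
Proof.
apply/quotient_continuous => v.
have -> : (fun l : projective_space R n => line_proj (direction l) x)
      \o \pi_(projective_space R n)%qT
    = (fun v : nonzero R n => line_proj (set_val v) x).
  apply/funext => w /=; have [k k0 ->] := direction_pi w.
  exact: line_projZ.
have cv : {for v, continuous (@set_val _ (nonzero R n))}.
  exact: initial_continuous.
have v0 : set_val v != 0 :> V by exact: (set_mem (valP v)).
have cs : {for v, continuous (fun w : nonzero R n =>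
    dot x (set_val w) / dot (set_val w) (set_val w))}.
  apply: continuousM.
    by apply: continuous_dot => //; exact: continuous_at_cst.
  by apply: continuousV; [rewrite dot_eq0|apply: continuous_dot].
exact: (continuous_scale cs cv).
Qed.

End LineDirection.

(** * The union of the lines has an interior point *)

Unset Implicit Arguments.

Theorem theorem5p2p8 (R : realType) (n : nat) (S : set 'rV[R]_n.+1)
    (L : set ('rV[R]_n.+1 * 'rV[R]_n.+1)) :
  is_sphere S -> is_line_bundle S L ->
  interior ((@codiagonal 'rV[R]_n.+1) @` L) <> set0.
Proof.
move=> [c [r [r0 SE]]] [phi [cphi LE]] int0.
set I := _ @` L in int0.
have mem_I p k : S p -> I (p + k *: direction (phi p)).
  move=> Sp; exists (p, k *: direction (phi p)) => //; rewrite LE; split=> //.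
  exact: direction_scale_mem.
have notI (P : set 'rV[R]_n.+1) (x : 'rV[R]_n.+1) :
    (\forall y \near x, P y) -> exists2 y, P y & ~ I y.
  move=> Px; apply: contrapT => PI; suff : interior I x by rewrite int0.
  apply: filterS Px => y Py; apply: contrapT => Iy.
  by apply: PI; exists y.
have ce x : {for x, continuous (fun y : 'rV[R]_n.+1 => enorm (y - c))}.
  apply: continuous_enorm; apply: continuous_add; last exact: continuous_at_cst.
  exact: continuous_at_id.
have [a ar Ia] : exists2 a, enorm (a - c) < r & ~ I a.
  apply: (notI [set a | enorm (a - c) < r] c); apply: (cvgr_lt _ (ce c)).
  by rewrite subrr enormE /dot big1 ?sqrtr0 // => i _; rewrite mxE mul0r.
pose w : 'rV[R]_n.+1 := delta_mx 0 0.
have w0 : w != 0.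
  by apply/eqP => /rowP/(_ 0)/eqP; rewrite !mxE !eqxx oner_eq0.
have ew : enorm w != 0 by rewrite gt_eqF // enorm_gt0.
have [b br Ib] : exists2 b, r < enorm (b - c) & ~ I b.
  apply: (notI [set b | r < enorm (b - c)] (c + (2 * r / enorm w) *: w)).
  apply: (cvgr_gt _ (ce _)).
  rewrite addrC addKr enormZ ger0_norm ?divr_ge0 ?enorm_ge0 ?mulr_ge0 ?ltW //.
  by rewrite divfK // ltr_pMl // ltr1n.
(* The bundle is turned into a family of lines off the origin, constant along
   rays from the centre. *)
pose g (y : 'rV[R]_n.+1) : 'rV[R]_n.+1 := (r / enorm y) *: y.
have cg y : y != 0 -> {for y, continuous g}.
  move=> y0; apply: continuous_scale; last exact: continuous_at_id.
  apply: continuousM; first exact: continuous_at_cst.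
  apply: continuousV; first by rewrite gt_eqF // enorm_gt0.
  by apply: continuous_enorm; exact: continuous_at_id.
have eg y : y != 0 -> enorm (g y) = r.
  move=> y0; rewrite enormZ ger0_norm ?divfK ?gt_eqF ?enorm_gt0 //.
  by rewrite divr_ge0 ?enorm_ge0 // ltW.
have Sg y : y != 0 -> S (c + g y) by move=> y0; rewrite SE /= addrC addKr eg.
pose u y := direction (phi (c + g y)).
have cu : continuous_line_field u.
  move=> y y0; split=> [|x]; first exact: direction_neq0.
  have ccg : {for y, continuous (fun z => c + g z)}.
    by apply: continuous_add; [exact: continuous_at_cst|exact: cg].
  have cphig : {for y, continuous (fun z => phi (c + g z))}.
    apply: (continuous_comp_within cphi ccg); near=> z; apply: Sg; near: z.
    exact: (cvgr_neq0 _ (@continuous_at_id _ y)).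
  exact: (continuous_comp cphig (@continuous_direction _ _ x _)).
have u_cone (k : R) y : 0 < k -> u (k *: y) = u y.
  move=> k0; have [->|y0] := eqVneq y 0; first by rewrite scaler0.
  suff gk : g (k *: y) = g y by rewrite /u gk.
  rewrite /g enormZ gtr0_norm // scalerA; congr (_ *: _); field.
  by rewrite !gt_eqF // enorm_gt0.
have offI d y k : ~ I d -> y != 0 -> g y - (d - c) <> k *: u y.
  move=> Id y0 gd; apply: Id; have -> : d = c + g y + (- k) *: u y.
    by rewrite scaleNr -gd opprB addrACA subrr addr0 addrC subrK.
  by apply: mem_I; exact: Sg.
have [||v Hv] := @transversal_line_section R n u (fun y => g y - (a - c)) cu u_cone.
- by move=> y y0; apply: continuous_add; [exact: cg|exact: continuous_at_cst].
- by move=> y k y0; apply/eqP; exact: offI.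
have [|y yr [k Hk]] := @no_transversal_field R n r (a - c) (b - c) v r0 ar br.
  by move=> y /Hv[].
have y0 : y != 0 by rewrite -enorm_gt0 yr.
have gy : g y = y by rewrite /g yr divff ?scale1r // gt_eqF.
have [_ _ [k' vk]] := Hv y y0.
move: Hk; rewrite vk scalerA -{1 3}gy => -[] H.
  exact: (offI _ _ _ Ia y0 H).
exact: (offI _ _ _ Ib y0 H).
Unshelve. all: by end_near. Qed.
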